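(* Let $$\mathcal R_{123}=\Psi_q\big(\kappa_1\kappa_3^{-1}e^{p_1+u_1+p_3-u_3-p_2}\big)\,\rho_{23}\,e^{\frac1\hbar p_1(u_3-u_2)}\,e^{\frac{\lambda_{23}}\hbar(u_3-u_1)},$$ put $n_{ij}=\frac{\lambda_{ij}}\hbar$, and assume $n_{23}\in\mathbb Z$. In the $p$-representation, the matrix elements of $\mathcal R_{123}$ are $$R^{c_1,c_2,c_3}_{d_1,d_2,d_3}(\lambda_1,\lambda_2,\lambda_3):=\langle c_1,c_2,c_3|\mathcal R_{123}|d_1,d_2,d_3\rangle=\frac{(-q)^{c_1-d_1+n_{23}}}{(q^2;q^2)_{c_1-d_1+n_{23}}}\,q^{(c_1-d_1+n_{23})(d_2-c_2+n_{13})}\,\delta^{c_2}_{d_1+d_3}\,\delta^{c_1+c_3}_{d_2}$$ for all $c_i,d_i\in\mathbb Z$.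
   Context: $\hbar$ is a generic complex parameter, $q=e^\hbar$, $q^x=e^{\hbar x}$; $\lambda_1,\lambda_2,\lambda_3\in\mathbb C$, $\kappa_j=e^{\lambda_j}$, $\lambda_{jk}=\lambda_j-\lambda_k$. $[p_i,u_j]=\hbar\delta_{ij}$, $[p_i,p_j]=[u_i,u_j]=0$ for $i,j\in\{1,2,3\}$; exponentials of linear combinations follow $e^Ae^B=e^{[A,B]/2}e^{A+B}$. $p$-representation: on $V=\bigoplus_{c\in\mathbb Z}\mathbb C|c\rangle$, for the $i$-th tensor factor of $V^{\otimes3}$, $e^{p_i}|c_i\rangle=q^{c_i}|c_i\rangle$ (more precisely $p_i|c_i\rangle=\hbar c_i|c_i\rangle$) and $e^{u_i}|c_i\rangle=|c_i+1\rangle$, so $e^{mu_i}|c_i\rangle=|c_i+m\rangle$ for $m\in\mathbb Z$, and $e^{\frac1\hbar p_1(u_3-u_2)}$ acts on vectors with first label $c_1$ as $e^{c_1(u_3-u_2)}$. $\rho_{23}$ exchanges the second and third components. $|c_1,c_2,c_3\rangle=|c_1\rangle\otimes|c_2\rangle\otimes|c_3\rangle$ and $\langle c_i|$ is the dual basis. $\Psi_q(U)=\sum_{n\ge0}\frac{(-qU)^n}{(q^2;q^2)_n}$ (matrix elements are computed termwise), $(z;q)_n=(z;q)_\infty/(zq^n;q)_\infty$ for $n\in\mathbb Z$ with $(z;q)_\infty=\prod_{k\ge0}(1-zq^k)$; in particular $1/(q^2;q^2)_n=0$ for $n<0$. $\delta^a_b$ is the Kronecker delta. *)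

(* Defs.v *)
From HB Require Import structures.
From mathcomp Require Import all_boot all_order all_algebra.
From mathcomp Require Import complex finmap monalg.
From mathcomp Require Import all_classical all_reals all_analysis.
From mathcomp Require Import ring.

Set Implicit Arguments.
Unset Strict Implicit.
Unset Printing Implicit Defensive.

Import Order.TTheory GRing.Theory Num.Theory.
Import numFieldNormedType.Exports.

Local Open Scope classical_set_scope.
Local Open Scope ring_scope.
Local Open Scope complex_scope.

Definition cexp (R : realType) (z : R[i]) : R[i] :=
  let: a +i* b := z in (expR a)%:C * (cos b +i* sin b).

(* q^x = e^{hbar x} *)
Definition qpow (R : realType) (hbar x : R[i]) : R[i] := cexp (hbar * x).

(* (z; q)_oo.  The topology of the complex field is carried by R[i]^o. *)
Definition qpoch_inf (R : realType) (z q : R[i]) : R[i] :=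
  limn (fun N => \prod_(k < N) (1 - z * q ^+ k) : R[i]^o).

(* (z; q)_n = (z; q)_oo / (z q^n; q)_oo for |q| < 1.  When |q| >= 1 the infinite
   products diverge, and (z; q)_n stands for the finite product to which the
   quotient telescopes.  Since x / 0 = 0 and 0^-1 = 0, the inverse of (z; q)_n
   is 0 whenever the denominator (z q^n; q)_oo vanishes; for z = q this covers
   every n < 0. *)
Definition qpoch (R : realType) (z q : R[i]) (n : int) : R[i] :=
  if `|q| < 1 then qpoch_inf z q / qpoch_inf (z * q ^ n) q
  else match n with
       | Posz m => \prod_(k < m) (1 - z * q ^+ k)
       | Negz m => (\prod_(k < m.+1) (1 - z * q ^- k.+1))^-1
       end.

(* V (x) V (x) V has the basis |c1,c2,c3> indexed by Z^3; the tensor factors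
   1, 2, 3 are numbered 0, 1, 2 in 'I_3. *)
Definition label := 'rV[int]_3.

Definition lbl (c1 c2 c3 : int) : label := \row_i [:: c1; c2; c3]`_i.

Definition V3 (R : realType) := {malg R[i][label]}.

Definition ket (R : realType) (c : label) : V3 R := << 1 *g c >>.

Definition linext (R : realType) (f : label -> V3 R) (v : V3 R) : V3 R :=
  \sum_(c <- msupp v) v@_c *: f c.

(* The pair (a, b) is the linear combination sum_i a_i p_i + sum_i b_i u_i. *)
Definition pu (R : realType) := ('rV[R[i]]_3 * 'rV[R[i]]_3)%type.

Definition pgen (R : realType) (j : 'I_3) : pu R := (delta_mx 0 j, 0).
Definition ugen (R : realType) (j : 'I_3) : pu R := (0, delta_mx 0 j).

(* [p_i, u_j] = hbar delta_ij, extended bilinearly *)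
Definition pubracket (R : realType) (hbar : R[i]) (X Y : pu R) : R[i] :=
  hbar * \sum_i (X.1 0 i * Y.2 0 i - X.2 0 i * Y.1 0 i).

Definition Cint (R : realType) (z : R[i]) : int :=
  xget 0 [set m : int | m%:~R = z].

(* e^X in the p-representation, for X = a.p + b.u with integral b.  By
   e^A e^B = e^{[A,B]/2} e^{A+B} with A = b.u and B = a.p,
     e^{a.p + b.u} = q^{(a.b)/2} e^{b.u} e^{a.p}. *)
Definition puexp (R : realType) (hbar : R[i]) (X : pu R) : V3 R -> V3 R :=
  linext (fun c => qpow hbar ((\sum_i X.1 0 i * X.2 0 i) / 2)
                   * qpow hbar (\sum_i X.1 0 i * (c 0 i)%:~R)
                   *: ket R (c + map_mx (@Cint R) X.2)).

(* e^{p_j X / hbar}, for X a combination of the u_i: p_j / hbar has the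
   eigenvalue c_j on |c>. *)
Definition puexp_ctrl (R : realType) (hbar : R[i]) (j : 'I_3) (X : pu R) :
    V3 R -> V3 R :=
  linext (fun c => puexp hbar ((c 0 j)%:~R *: X) (ket R c)).

Definition rho (R : realType) (j k : 'I_3) : V3 R -> V3 R :=
  linext (fun c => ket R (xcol j k c)).

(* <c| Psi_q(U) |v>, computed termwise.  Psi_q(U) v need not have finite
   support, so that it is only given by its coordinates. *)
Definition Psi (R : realType) (q : R[i]) (U : V3 R -> V3 R) (v : V3 R)
    (c : label) : R[i] :=
  limn (fun N => \sum_(n < N)
    (iter n (fun w => - q *: U w) v)@_c / qpoch (q ^+ 2) (q ^+ 2) n : R[i]^o).

Definition R123 (R : realType) (hbar l1 l2 l3 : R[i]) :
    V3 R -> label -> R[i] :=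
  let p1 := pgen R 0 in let p2 := pgen R 1 in let p3 := pgen R 2 in
  let u1 := ugen R 0 in let u2 := ugen R 1 in let u3 := ugen R 2 in
  fun v =>
  Psi (cexp hbar)
      (fun w => (cexp l1 * (cexp l3)^-1)
                *: puexp hbar (p1 + u1 + p3 - u3 - p2) w)
      (rho 1 2
        (puexp_ctrl hbar 0 (u3 - u2)
          (puexp hbar (((l2 - l3) / hbar) *: (u3 - u1)) v))).

(* <c1,c2,c3| R_123 |d1,d2,d3> *)
Definition Rmat (R : realType) (hbar l1 l2 l3 : R[i])
    (c1 c2 c3 d1 d2 d3 : int) : R[i] :=
  R123 hbar l1 l2 l3 (ket R (lbl d1 d2 d3)) (lbl c1 c2 c3).

(* q is not a root of unity; in particular hbar != 0. *)
Definition generic (R : realType) (hbar : R[i]) : Prop :=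
  forall m : nat, (0 < m)%N -> cexp hbar ^+ m != 1.

Lemma cexp0 (R : realType) : cexp (0 : R[i]) = 1.
Proof. by rewrite /cexp /= expR0 cos0 sin0 mul1r. Qed.

Lemma cexpD (R : realType) (x y : R[i]) : cexp (x + y) = cexp x * cexp y.
Proof.
case: x y => [a b] [c d]; rewrite /cexp /= expRD cosD sinD.
by simpc; congr (_ +i* _); ring.
Qed.

Lemma CintE (R : realType) (m : int) : Cint (m%:~R : R[i]) = m.
Proof.
rewrite /Cint; case: xgetP => [x _ /= /intr_inj //|].
by move=> /(_ m) /= /(_ erefl).
Qed.

Lemma linextD (R : realType) (f : label -> V3 R) a v w :
  linext f (a *: v + w) = a *: linext f v + linext f w.
Proof.
have E (x : V3 R) d : (msupp x `<=` d)%fset ->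
    linext f x = \sum_(c <- d) x@_c *: f c.
  move=> s; rewrite /linext; apply: big_fset_incl => // k _ kx.
  by rewrite (mcoeff_outdom kx) scale0r.
pose d := (msupp v `|` msupp w `|` msupp (a *: v + w))%fset.
have dv : (msupp v `<=` d)%fset by rewrite /d -fsetUA fsubsetUl.
have dw : (msupp w `<=` d)%fset.
  by rewrite /d [(msupp v `|` _)%fset]fsetUC -fsetUA fsubsetUl.
have dvw : (msupp (a *: v + w) `<=` d)%fset by rewrite /d fsubsetUr.
rewrite (E _ _ dv) (E _ _ dw) (E _ _ dvw).
rewrite scaler_sumr -big_split /=; apply: eq_bigr => k _.
by rewrite mcoeffD mcoeffZ scalerDl scalerA.
Qed.

Lemma linext_ket (R : realType) (f : label -> V3 R) c :
  linext f (ket R c) = f c.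
Proof.
by rewrite /linext msuppU oner_eq0 big_seq_fset1 mcoeffUU scale1r.
Qed.

Lemma linext0 (R : realType) (f : label -> V3 R) : linext f 0 = 0.
Proof. by rewrite /linext msupp0 big_seq_fset0. Qed.

Lemma linextZ (R : realType) (f : label -> V3 R) a v :
  linext f (a *: v) = a *: linext f v.
Proof. by rewrite -[a *: v]addr0 linextD linext0 addr0. Qed.

Lemma linext_comp (R : realType) (f g : label -> V3 R) v :
  linext f (linext g v) = linext (fun c => linext f (g c)) v.
Proof.
have fD x y : linext f (x + y) = linext f x + linext f y.
  by rewrite -{1}[x]scale1r linextD scale1r.
have -> : linext g v = \sum_(c <- msupp v) v@_c *: g c by [].
rewrite (big_morph _ fD (linext0 f)); apply: eq_bigr => c _.
exact: linextZ.
Qed.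

Lemma puexp_ket (R : realType) (hbar : R[i]) (X : pu R) c :
  puexp hbar X (ket R c)
  = qpow hbar ((\sum_i X.1 0 i * X.2 0 i) / 2 + \sum_i X.1 0 i * (c 0 i)%:~R)
    *: ket R (c + map_mx (@Cint R) X.2).
Proof. by rewrite /puexp linext_ket /qpow mulrDr cexpD. Qed.

(* e^X e^Y = e^{[X,Y]/2} e^{X+Y} *)
Lemma puexpD (R : realType) (hbar : R[i]) (X Y : pu R) (a b : label) v :
    X.2 = map_mx intr a -> Y.2 = map_mx intr b ->
  puexp hbar X (puexp hbar Y v)
  = cexp (pubracket hbar X Y / 2) *: puexp hbar (X + Y) v.
Proof.
case: X Y => [x xa] [y yb] /= Xa Yb; subst xa yb.
have lab (c : label) : c + map_mx (@Cint R) (map_mx intr b)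
    + map_mx (@Cint R) (map_mx intr a)
    = c + map_mx (@Cint R) (map_mx intr a + map_mx intr b).
  apply/rowP=> i; rewrite !mxE -intrD !CintE -addrA; congr (_ + _).
  exact: addrC.
have kets c : puexp hbar (x, map_mx intr a)
      (puexp hbar (y, map_mx intr b) (ket R c))
    = cexp (pubracket hbar (x, map_mx intr a) (y, map_mx intr b) / 2)
      *: puexp hbar (x + y, map_mx intr a + map_mx intr b) (ket R c).
  rewrite !puexp_ket [X in X = _]linextZ -/(puexp _ _ _) puexp_ket /=.
  rewrite !scalerA lab; move: (ket R _) => k.
  apply: (f_equal (fun z => z *: k)).
  rewrite /qpow -!cexpD; congr cexp; rewrite /pubracket /=.
  rewrite !mulr_suml -!big_split /= !mulr_sumr -!big_split /= mulr_suml.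
  rewrite -big_split /=; apply: eq_bigr => i _.
  by rewrite !mxE CintE intrD; field.
have puE X w : puexp hbar X w = linext (fun c => puexp hbar X (ket R c)) w.
  by apply: eq_bigr => c _; rewrite /puexp linext_ket.
have linextM (f : label -> V3 R) e w :
    linext (fun c => e *: f c) w = e *: linext f w.
  rewrite /linext scaler_sumr; apply: eq_bigr => c _.
  by rewrite !scalerA; move: (f c) => k; rewrite mulrC.
rewrite (puE (y, _) v) {1}/puexp linext_comp -!/(puexp _ _ _).
rewrite (puE _ v) -linextM; apply: eq_bigr => c _.
by apply: (f_equal (fun z => _ *: z)); exact: kets.
Qed.

(* Main.v *)
(**
The three rightmost factors of R_123 send |d1,d2,d3> to the single basis vector
|d1 - n23, d1 + d3, d2 - d1 + n23>.  On it U = k1 k3^-1 e^{p1+u1+p3-u3-p2} acts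
by the scalar k1 k3^-1 q^{c1-c2+c3} and the shift (c1,c2,c3) -> (c1+1,c2,c3-1).
The exponents of p and u are orthogonal, so no factor q^{1/2} appears, and the
scalar is invariant under the shift, so U^n contributes its n-th power.  Hence
at most one term of the series, n = c1 - d1 + n23, has a nonzero matrix element.
When this n is negative there is none, in agreement with 1/(q^2;q^2)_n = 0.
*)

Require Import Defs.
From mathcomp Require Import all_boot all_order all_algebra.
From mathcomp Require Import perm complex finmap monalg.
From mathcomp Require Import all_classical all_reals all_analysis.
From mathcomp Require Import ring zify.
Import Order.TTheory GRing.Theory Num.Theory.
Local Open Scope ring_scope.
Local Open Scope complex_scope.

Lemma cexp_neq0 (R : realType) (x : R[i]) : cexp x != 0.
Proof.
apply/eqP => x0; have := cexpD x (- x); rewrite subrr cexp0 x0 mul0r.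
exact/eqP/oner_neq0.
Qed.

Lemma cexpN (R : realType) (x : R[i]) : cexp (- x) = (cexp x)^-1.
Proof.
by apply: (mulfI (cexp_neq0 _ x)); rewrite -cexpD subrr cexp0 mulfV ?cexp_neq0.
Qed.

Lemma cexpMn (R : realType) (x : R[i]) (n : nat) : cexp (x *+ n) = cexp x ^+ n.
Proof.
by elim: n => [|n IHn]; rewrite ?mulr0n ?cexp0 // mulrS cexpD IHn exprS.
Qed.

(** All limits evaluated below are of eventually constant sequences, so no convergence estimate
    enters; separation of the complex topology identifies the limit. *)
Lemma limn_near_cst (R : realType) (u : nat -> R[i]) (l : R[i]) (N : nat) :
  (forall n, (N <= n)%N -> u n = l) -> limn (u : nat -> R[i]^o) = l.
Proof.
move=> ul; apply: (@lim_near_cst _ (norm_hausdorff (V := R[i]^o))).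
by exists N => // n /= /ul.
Qed.

(** Every partial product beyond index [k] contains a zero factor, whatever the modulus of [q]. *)
Lemma qpoch_inf_eq0 (R : realType) (z q : R[i]) (k : nat) :
  z * q ^+ k = 1 -> qpoch_inf z q = 0.
Proof.
move=> zq; apply: (@limn_near_cst _ _ _ k.+1) => n kn.
by rewrite (bigD1 (Ordinal kn)) //= zq subrr mul0r.
Qed.

(** As [Negz n] is -(n+1), the factor k = n of (q q^(-n-1); q)_oo vanishes when |q| < 1, and the
    quotient by it is 0 by convention. Otherwise the factor k = 0 of the finite product, 1 - q q^-1,
    vanishes. *)
Lemma qpoch_self_neg (R : realType) (q : R[i]) (n : nat) :
  q != 0 -> (qpoch q q (Negz n))^-1 = 0.
Proof.
move=> q0; rewrite /qpoch; case: ifP => _.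
  rewrite (@qpoch_inf_eq0 _ (q * q ^ Negz n) q n) ?invr0 ?mulr0 ?invr0 //.
  by rewrite mulrAC NegzE -exprnN -exprS divff // expf_neq0.
by rewrite big_ord_recl expr1 divff // subrr mul0r !invr0.
Qed.

Lemma mcoeff_scale_ket (R : realType) (a : R[i]) (l c : label) :
  (a *: ket R l)@_c = a * (c == l)%:R.
Proof. by rewrite mcoeffZ mcoeffU eq_sym. Qed.

Lemma eq_lbl (a b c a' b' c' : int) :
  (lbl a b c == lbl a' b' c') = [&& a == a', b == b' & c == c'].
Proof.
apply/eqP/and3P => [/rowP e|[/eqP-> /eqP-> /eqP->//]].
by move: (e 0) (e 1) (e 2); rewrite !mxE /= => -> -> ->; rewrite !eqxx.
Qed.

Lemma rV3P (T : Type) (l l' : 'rV[T]_3) :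
  l 0 0 = l' 0 0 -> l 0 1 = l' 0 1 -> l 0 2 = l' 0 2 -> l = l'.
Proof.
move=> e0 e1 e2; apply/rowP => -[[|[|[|//]]] i3].
- by rewrite (_ : Ordinal i3 = 0) //; apply: val_inj.
- by rewrite (_ : Ordinal i3 = 1) //; apply: val_inj.
- by rewrite (_ : Ordinal i3 = 2) //; apply: val_inj.
Qed.

Lemma sum_ord3 (V : nmodType) (F : 'I_3 -> V) : \sum_i F i = F 0 + F 1 + F 2.
Proof.
rewrite !big_ord_recl big_ord0 addr0 addrA.
by congr (_ + F _ + F _); apply: val_inj.
Qed.

Lemma puexp_u (R : realType) (hbar : R[i]) (b c : label) :
  puexp hbar (0, map_mx intr b) (ket R c) = ket R (c + b).
Proof.
have sum0 (f : 'I_3 -> R[i]) : \sum_i (0 : 'rV[R[i]]_3) 0 i * f i = 0.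
  by rewrite big1 // => i _; rewrite mxE mul0r.
rewrite puexp_ket /= !sum0 mul0r addr0 /qpow mulr0 cexp0 scale1r; congr (ket _ (_ + _)).
by apply/rowP => i; rewrite !mxE CintE.
Qed.

Lemma puexp_u31 (R : realType) (hbar : R[i]) (n c1 c2 c3 : int) :
  puexp hbar (n%:~R *: (ugen R 2 - ugen R 0)) (ket R (lbl c1 c2 c3))
  = ket R (lbl (c1 - n) c2 (c3 + n)).
Proof.
have -> : n%:~R *: (ugen R 2 - ugen R 0) = (0, map_mx intr (lbl (- n) 0 n)).
  congr pair; first by rewrite /= subrr scaler0.
  by apply: rV3P; rewrite !mxE /=; ring.
by rewrite puexp_u; congr (ket _); apply: rV3P; rewrite !mxE /= ?addr0.
Qed.

Lemma puexp_ctrl_u32 (R : realType) (hbar : R[i]) (c1 c2 c3 : int) :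
  puexp_ctrl hbar 0 (ugen R 2 - ugen R 1) (ket R (lbl c1 c2 c3))
  = ket R (lbl c1 (c2 - c1) (c3 + c1)).
Proof.
rewrite /puexp_ctrl linext_ket mxE /=.
have -> : c1%:~R *: (ugen R 2 - ugen R 1) = (0, map_mx intr (lbl 0 (- c1) c1)).
  congr pair; first by rewrite /= subrr scaler0.
  by apply: rV3P; rewrite !mxE /=; ring.
by rewrite puexp_u; congr (ket _); apply: rV3P; rewrite !mxE /= ?addr0.
Qed.

Lemma rho23_ket (R : realType) (c1 c2 c3 : int) :
  rho 1 2 (ket R (lbl c1 c2 c3)) = ket R (lbl c1 c3 c2).
Proof.
rewrite /rho linext_ket; congr (ket _).
by apply: rV3P; rewrite !mxE ?tpermL ?tpermR ?tpermD.
Qed.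

Lemma puexp_R123 (R : realType) (hbar : R[i]) (c1 c2 c3 : int) :
  puexp hbar (pgen R 0 + ugen R 0 + pgen R 2 - ugen R 2 - pgen R 1)
    (ket R (lbl c1 c2 c3))
  = qpow hbar (c1 - c2 + c3)%:~R *: ket R (lbl (c1 + 1) c2 (c3 - 1)).
Proof.
rewrite puexp_ket !sum_ord3 !mxE /=.
have -> : lbl c1 c2 c3 + map_mx (@Cint R)
    ((pgen R 0 + ugen R 0 + pgen R 2 - ugen R 2 - pgen R 1).2)
    = lbl (c1 + 1) c2 (c3 - 1).
  (* The u-coordinates are 1, 0, -1; [CintE] is restated for these literals, without the integer
     casts. *)
  have C0 := CintE R 0; have C1 := CintE R 1; have CN1 := CintE R (-1).
  rewrite ?(mulr0z, mulr1z, mulrNz) in C0 C1 CN1.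
  by apply: rV3P; rewrite !mxE /= !(addr0, add0r, subr0, oppr0)
    ?C0 ?C1 ?CN1 ?addr0.
apply: (f_equal (fun z => qpow hbar z *: _)).
by rewrite intrD intrB; field.
Qed.

Lemma iter_scale_puexp_R123 (R : realType) (hbar a k : R[i]) (c1 c2 c3 : int) (n : nat) :
  iter n (fun w => a *: (k *: puexp hbar
      (pgen R 0 + ugen R 0 + pgen R 2 - ugen R 2 - pgen R 1) w))
    (ket R (lbl c1 c2 c3))
  = (a * k * qpow hbar (c1 - c2 + c3)%:~R) ^+ n
    *: ket R (lbl (c1 + n%:Z) c2 (c3 - n%:Z)).
Proof.
elim: n => [|n IHn]; first by rewrite expr0 scale1r addr0 subr0.
rewrite iterS IHn [puexp _ _ _]linextZ -/(puexp _ _ _) puexp_R123 !scalerA.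
have -> : c1 + n%:Z - c2 + (c3 - n%:Z) = c1 - c2 + c3 by ring.
have -> : c1 + n%:Z + 1 = c1 + n.+1%:Z by lia.
have -> : c3 - n%:Z - 1 = c3 - n.+1%:Z by lia.
by apply: (f_equal (fun z => z *: _)); rewrite exprS; ring.
Qed.

Theorem proposition6p4 (R : realType) (hbar l1 l2 l3 : R[i]) (n23 : int)
    (hgeneric : generic hbar)
    (hn23 : (l2 - l3) / hbar = n23%:~R)
    (c1 c2 c3 d1 d2 d3 : int) :
  let q := cexp hbar in
  let n13 := (l1 - l3) / hbar in
  Rmat hbar l1 l2 l3 c1 c2 c3 d1 d2 d3 =
    (- q) ^ (c1 - d1 + n23) / qpoch (q ^+ 2) (q ^+ 2) (c1 - d1 + n23)
    * qpow hbar ((c1 - d1 + n23)%:~R * ((d2 - c2)%:~R + n13))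
    * (c2 == d1 + d3)%:R * (c1 + c3 == d2)%:R.
Proof.
move=> q n13.
have hbar0 : hbar != 0.
  by apply/eqP => h0; have := hgeneric 1%N isT; rewrite h0 cexp0 expr1 eqxx.
have q0 : q != 0 by exact: cexp_neq0.
rewrite /Rmat /R123 hn23 puexp_u31 puexp_ctrl_u32 rho23_ket /Psi -/q.
set m := c1 - d1 + n23.
(* The scalar contributed by each application of -qU, starting from the image of |d1,d2,d3> under
   the three rightmost factors. *)
set z := - q * (cexp l1 * (cexp l3)^-1)
  * qpow hbar (d1 - n23 - (d3 + n23 + (d1 - n23)) + (d2 - (d1 - n23)))%:~R.
have termE (n : nat) :
    (iter n (fun w => - q *: (cexp l1 * (cexp l3)^-1 *: puexp hbar
        (pgen R 0 + ugen R 0 + pgen R 2 - ugen R 2 - pgen R 1) w))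
      (ket R (lbl (d1 - n23) (d3 + n23 + (d1 - n23)) (d2 - (d1 - n23)))))
      @_(lbl c1 c2 c3)
    = z ^+ n * [&& n%:Z == m, c2 == d1 + d3 & c1 + c3 == d2]%:R.
  rewrite iter_scale_puexp_R123 mcoeff_scale_ket eq_lbl; congr (_ * (nat_of_bool _)%:R).
  (* The first label fixes n = m; adding the first and third labels eliminates n and leaves c1 + c3
     = d2. *)
  by apply/and3P/and3P => -[] /eqP e1 /eqP e2 /eqP e3;
    split; apply/eqP; rewrite /m in e1 *; lia.
under eq_fun do under eq_bigr do rewrite termE.
case: (c2 =P d1 + d3) => [e2|_]; last first.
  rewrite mulr0 mul0r; apply: (@limn_near_cst _ _ _ 0) => n _.
  by rewrite big1 // => i _; rewrite /= andbF mulr0 mul0r.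
case: (c1 + c3 =P d2) => [e3|_]; last first.
  rewrite mulr0; apply: (@limn_near_cst _ _ _ 0) => n _.
  by rewrite big1 // => i _; rewrite /= andbF mulr0 mul0r.
rewrite !mulr1; case: m termE => p _.
  (* For m = p >= 0 the partial sums reduce to the term of index p as soon as they have at least p +
     1 terms. *)
  apply: (@limn_near_cst _ _ _ p.+1) => n pn.
  rewrite (bigD1 (Ordinal pn)) //= big1 => [|i ip]; last first.
    move: ip; rewrite -val_eqE => /negPf /= ip.
    by rewrite eqz_nat andbT ip mulr0 mul0r.
  rewrite eqxx addr0 mulr1 mulrAC; congr (_ / _).
  rewrite /z -mulrA exprMn; congr (_ * _).
  (* The factor k1 k3^-1 is absorbed as q^n13, since hbar n13 = l1 - l3; this is where [hbar0] is
     used. *)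
  rewrite -cexpN -cexpD /qpow -cexpD -cexpMn; congr cexp.
  have -> : d1 - n23 - (d3 + n23 + (d1 - n23)) + (d2 - (d1 - n23)) = d2 - c2.
    by rewrite e2; ring.
  by rewrite -mulr_natl mulrDr mulrCA -pmulrn /n13; field.
(* For m < 0 the right side is 0, and no natural number n equals m, so every partial sum is 0
   too. *)
rewrite qpoch_self_neg ?expf_neq0 // mulr0 mul0r.
by apply: (@limn_near_cst _ _ _ 0) => n _;
  rewrite big1 // => i _; rewrite mulr0 mul0r.
Qed.
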